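(* Let $\mathbb F$ be a field, $n\ge5$, and let $\mathcal O_{\mathfrak q}((\mathbb F^\ast)^n)$ be a quantum torus defined by a multiplicatively antisymmetric matrix $\mathfrak q=(q_{ij})$ over $\mathbb F^\ast$ such that $$q_{12}=q_{13}=\cdots=q_{1(n-2)}=1$$ and the remaining multiparameters $q_{1(n-1)},q_{1n},q_{23},q_{24},\dots,q_{(n-1)n}$ (i.e. $q_{1(n-1)}$, $q_{1n}$, and all $q_{ij}$ with $2\le i<j\le n$) are multiplicatively independent in $\mathbb F^\ast$. Then $$\mathrm{Aut}(\mathbb Z^n,\lambda)\cong\mathbb Z_2,$$ and consequently there is a short exact sequence of groups $$1\to \mathrm{Hom}(\mathbb Z^n,\mathbb F^\ast)\to \mathrm{Aut}(\mathcal O_{\mathfrak q}((\mathbb F^\ast)^n))\to\mathbb Z_2\to1.$$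
   Context: Multiplicatively antisymmetric means $q_{ii}=1$ and $q_{ji}=q_{ij}^{-1}$. The quantum torus $\mathcal O_{\mathfrak q}((\mathbb F^\ast)^n)$ is the $\mathbb F$-algebra generated by $X_1^{\pm1},\dots,X_n^{\pm1}$ subject to $X_iX_j=q_{ij}X_jX_i$. Elements of $\mathbb F^\ast$ are (multiplicatively) independent if they freely generate a free abelian subgroup of $\mathbb F^\ast$. For $\mathbf m\in\mathbb Z^n$ put $\mathbf X^{\mathbf m}=X_1^{m_1}\cdots X_n^{m_n}$ and $\lambda(\mathbf m,\mathbf m')=\mathbf X^{\mathbf m}\mathbf X^{\mathbf m'}(\mathbf X^{\mathbf m})^{-1}(\mathbf X^{\mathbf m'})^{-1}\in\mathbb F^\ast$, an alternating $\mathbb Z$-bilinear map with $\lambda(\mathbf e_i,\mathbf e_j)=q_{ij}$. $\mathrm{Aut}(\mathbb Z^n,\lambda)$ is the group of all $\sigma\in\mathrm{GL}(n,\mathbb Z)$ with $\lambda(\sigma\mathbf m,\sigma\mathbf m')=\lambda(\mathbf m,\mathbf m')$ for all $\mathbf m,\mathbf m'\in\mathbb Z^n$. Automorphisms of the algebra are $\mathbb F$-automorphisms. The units of the quantum torus are the elements $\alpha\mathbf X^{\mathbf m}$ with $\alpha\in\mathbb F^\ast$, so an automorphism induces an automorphism of (units)$/\mathbb F^\ast\cong\mathbb Z^n$; the image of $\mathrm{Aut}(\mathcal O_{\mathfrak q}((\mathbb F^\ast)^n))$ in $\mathrm{GL}(n,\mathbb Z)$ is $\mathrm{Aut}(\mathbb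 Z^n,\lambda)$, and the kernel consists of the scalar automorphisms $\mathbf X^{\mathbf m}\mapsto\phi(\mathbf m)\mathbf X^{\mathbf m}$, $\phi\in\mathrm{Hom}(\mathbb Z^n,\mathbb F^\ast)$. The maps in the exact sequence are these. *)

(* Defs.v *)
From HB Require Import structures.
From mathcomp Require Import all_boot all_order all_algebra.
From mathcomp Require Import boolp.

Set Implicit Arguments.
Unset Strict Implicit.
Unset Printing Implicit Defensive.

Import GRing.Theory.
Local Open Scope ring_scope.

Definition mult_antisymmetric (F : fieldType) n (q : 'M[F]_n) : Prop :=
  [/\ forall i j, q i j != 0,
      forall i, q i i = 1
    & forall i j, q j i = (q i j)^-1].

(* The family (a i)_{i | P i} of F^* freely generates a free abelian subgroup. *)
Definition mult_independent (F : fieldType) (I : finType) (P : pred I)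
    (a : I -> F) : Prop :=
  (forall i, P i -> a i != 0) /\
  (forall k : I -> int,
     \prod_(i | P i) a i ^ k i = 1 -> forall i, P i -> k i = 0).

Definition torus_relations (F : fieldType) n (q : 'M[F]_n) (B : unitAlgType F)
    (Y : 'I_n -> B) : Prop :=
  (forall i, Y i \is a GRing.unit) /\
  (forall i j, Y i * Y j = q i j *: (Y j * Y i)).

(* (A, X) is the F-algebra generated by X_1^{+-1}, ..., X_n^{+-1} subject to
   X_i X_j = q_ij X_j X_i: the presentation is rendered by its universal
   property, which determines (A, X) up to unique isomorphism. *)
Definition is_quantum_torus (F : fieldType) n (q : 'M[F]_n)
    (A : unitAlgType F) (X : 'I_n -> A) : Prop :=
  torus_relations q X /\
  (forall (B : unitAlgType F) (Y : 'I_n -> B), torus_relations q Y ->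
     exists2 f : {lrmorphism A -> B}, (forall i, f (X i) = Y i) &
       forall g : {lrmorphism A -> B}, (forall i, g (X i) = Y i) -> g =1 f).

(* Z^n is the type of integer column vectors; the product is ordered. *)
Definition monomial (F : fieldType) n (A : unitAlgType F) (X : 'I_n -> A)
    (m : 'cV[int]_n) : A :=
  \prod_(i < n) X i ^ m i 0.

(* In a quantum torus this commutator lies in F^* . 1, a copy of F^* in A. *)
Definition torus_lambda (F : fieldType) n (A : unitAlgType F) (X : 'I_n -> A)
    (m m' : 'cV[int]_n) : A :=
  monomial X m * monomial X m' * (monomial X m)^-1 * (monomial X m')^-1.

Definition lambda_preserving n (T : Type) (lam : 'cV[int]_n -> 'cV[int]_n -> T)
    (s : 'M[int]_n) : bool :=
  (s \in unitmx) && `[< forall m m', lam (s *m m) (s *m m') = lam m m' >].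

Record lambda_aut n (T : Type) (lam : 'cV[int]_n -> 'cV[int]_n -> T) :=
  LambdaAut { lambda_aut_mx :> 'M[int]_n;
              lambda_autP : lambda_preserving lam lambda_aut_mx }.

HB.instance Definition _ n T (lam : 'cV[int]_n -> 'cV[int]_n -> T) :=
  [isSub for @lambda_aut_mx n T lam].
HB.instance Definition _ n T (lam : 'cV[int]_n -> 'cV[int]_n -> T) :=
  [Choice of lambda_aut lam by <:].

Lemma lambda_preserving1 n T (lam : 'cV[int]_n -> 'cV[int]_n -> T) :
  lambda_preserving lam 1%:M.
Proof.
by rewrite /lambda_preserving unitmx1; apply/asboolP => m m'; rewrite !mul1mx.
Qed.

Lemma lambda_preservingM n T (lam : 'cV[int]_n -> 'cV[int]_n -> T)
    (s t : lambda_aut lam) :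
  lambda_preserving lam (s *m t).
Proof.
have /andP[su /asboolP sP] := lambda_autP s.
have /andP[tu /asboolP tP] := lambda_autP t.
apply/andP; split; first by rewrite unitmx_mul su.
by apply/asboolP => m m'; rewrite -!mulmxA sP tP.
Qed.

Lemma lambda_preservingV n T (lam : 'cV[int]_n -> 'cV[int]_n -> T)
    (s : lambda_aut lam) :
  lambda_preserving lam (invmx s).
Proof.
have /andP[su /asboolP sP] := lambda_autP s; apply/andP; split.
  by rewrite unitmx_inv.
by apply/asboolP => m m'; rewrite -sP !mulKVmx.
Qed.

Definition lambda_aut_one n T (lam : 'cV[int]_n -> 'cV[int]_n -> T) :=
  LambdaAut (lambda_preserving1 lam).
Definition lambda_aut_mul n T (lam : 'cV[int]_n -> 'cV[int]_n -> T)
    (s t : lambda_aut lam) := LambdaAut (lambda_preservingM s t).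
Definition lambda_aut_inv n T (lam : 'cV[int]_n -> 'cV[int]_n -> T)
    (s : lambda_aut lam) := LambdaAut (lambda_preservingV s).

Lemma lambda_aut_mulA n T (lam : 'cV[int]_n -> 'cV[int]_n -> T) :
  associative (@lambda_aut_mul n T lam).
Proof. by move=> s t u; apply: val_inj; rewrite /= mulmxA. Qed.

Lemma lambda_aut_mul1 n T (lam : 'cV[int]_n -> 'cV[int]_n -> T) :
  left_id (lambda_aut_one lam) (@lambda_aut_mul n T lam).
Proof. by move=> s; apply: val_inj; rewrite /= mul1mx. Qed.

Lemma lambda_aut_mulr1 n T (lam : 'cV[int]_n -> 'cV[int]_n -> T) :
  right_id (lambda_aut_one lam) (@lambda_aut_mul n T lam).
Proof. by move=> s; apply: val_inj; rewrite /= mulmx1. Qed.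

Lemma lambda_aut_mulV n T (lam : 'cV[int]_n -> 'cV[int]_n -> T) :
  left_inverse (lambda_aut_one lam) (@lambda_aut_inv n T lam)
    (@lambda_aut_mul n T lam).
Proof.
by move=> s; apply: val_inj; rewrite /= mulVmx //; case/andP: (lambda_autP s).
Qed.

Lemma lambda_aut_mulrV n T (lam : 'cV[int]_n -> 'cV[int]_n -> T) :
  right_inverse (lambda_aut_one lam) (@lambda_aut_inv n T lam)
    (@lambda_aut_mul n T lam).
Proof.
by move=> s; apply: val_inj; rewrite /= mulmxV //; case/andP: (lambda_autP s).
Qed.

HB.instance Definition _ n T (lam : 'cV[int]_n -> 'cV[int]_n -> T) :=
  isGroup.Build (lambda_aut lam) (@lambda_aut_mulA n T lam)
    (@lambda_aut_mul1 n T lam) (@lambda_aut_mulr1 n T lam)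
    (@lambda_aut_mulV n T lam) (@lambda_aut_mulrV n T lam).

(* Hom(Z^n, F^* ) as nowhere-zero maps to F, multiplied pointwise. *)
Definition is_zhom (F : fieldType) n (phi : 'cV[int]_n -> F) : bool :=
  `[< (forall m, phi m != 0) /\
      (forall m m', phi (m + m') = phi m * phi m') >].

Record zhom (F : fieldType) n :=
  ZHom { zhom_fun :> 'cV[int]_n -> F; zhomP : is_zhom zhom_fun }.

HB.instance Definition _ (F : fieldType) n := [isSub for @zhom_fun F n].
HB.instance Definition _ (F : fieldType) n := [Choice of zhom F n by <:].

Lemma is_zhom1 (F : fieldType) n : is_zhom (fun _ : 'cV[int]_n => 1 : F).
Proof. by apply/asboolP; split=> *; rewrite ?oner_eq0 ?mulr1. Qed.

Lemma is_zhomM (F : fieldType) n (phi psi : zhom F n) :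
  is_zhom (fun m => phi m * psi m).
Proof.
have /asboolP[phi0 phiD] := zhomP phi; have /asboolP[psi0 psiD] := zhomP psi.
apply/asboolP; split=> [m|m m']; first by rewrite mulf_neq0.
by rewrite phiD psiD mulrACA.
Qed.

Lemma is_zhomV (F : fieldType) n (phi : zhom F n) :
  is_zhom (fun m => (phi m)^-1).
Proof.
have /asboolP[phi0 phiD] := zhomP phi.
by apply/asboolP; split=> [m|m m']; rewrite ?invr_eq0 // phiD invfM.
Qed.

Definition zhom_one (F : fieldType) n := ZHom (is_zhom1 F n).
Definition zhom_mul (F : fieldType) n (phi psi : zhom F n) :=
  ZHom (is_zhomM phi psi).
Definition zhom_inv (F : fieldType) n (phi : zhom F n) := ZHom (is_zhomV phi).

Lemma zhom_mulA (F : fieldType) n : associative (@zhom_mul F n).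
Proof.
by move=> f g h; apply: val_inj; apply/funext => m /=; rewrite mulrA.
Qed.

Lemma zhom_mul1 (F : fieldType) n : left_id (zhom_one F n) (@zhom_mul F n).
Proof. by move=> f; apply: val_inj; apply/funext => m /=; rewrite mul1r. Qed.

Lemma zhom_mulr1 (F : fieldType) n : right_id (zhom_one F n) (@zhom_mul F n).
Proof. by move=> f; apply: val_inj; apply/funext => m /=; rewrite mulr1. Qed.

Lemma zhom_mulV (F : fieldType) n :
  left_inverse (zhom_one F n) (@zhom_inv F n) (@zhom_mul F n).
Proof.
move=> f; apply: val_inj; apply/funext => m /=.
by case/asboolP: (zhomP f) => f0 _; rewrite mulVf.
Qed.

Lemma zhom_mulrV (F : fieldType) n :
  right_inverse (zhom_one F n) (@zhom_inv F n) (@zhom_mul F n).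
Proof.
move=> f; apply: val_inj; apply/funext => m /=.
by case/asboolP: (zhomP f) => f0 _; rewrite mulfV.
Qed.

HB.instance Definition _ (F : fieldType) n :=
  isGroup.Build (zhom F n) (@zhom_mulA F n) (@zhom_mul1 F n) (@zhom_mulr1 F n)
    (@zhom_mulV F n) (@zhom_mulrV F n).

Definition is_alg_aut (F : fieldType) (A : algType F) (f : A -> A) : bool :=
  `[< [/\ linear f, monoid_morphism f & bijective f] >].

Record alg_aut (F : fieldType) (A : algType F) :=
  AlgAut { alg_aut_fun :> A -> A; alg_autP : is_alg_aut alg_aut_fun }.

HB.instance Definition _ (F : fieldType) (A : algType F) :=
  [isSub for @alg_aut_fun F A].
HB.instance Definition _ (F : fieldType) (A : algType F) :=
  [Choice of alg_aut A by <:].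

Lemma is_alg_aut1 (F : fieldType) (A : algType F) : is_alg_aut (@id A).
Proof. by apply/asboolP; split=> //; exists id. Qed.

Lemma is_alg_autM (F : fieldType) (A : algType F) (f g : alg_aut A) :
  is_alg_aut (f \o g).
Proof.
have /asboolP[fL [f1 fM] fB] := alg_autP f.
have /asboolP[gL [g1 gM] gB] := alg_autP g.
apply/asboolP; split; last exact: bij_comp.
- by move=> a x y; rewrite /= gL fL.
- by split=> [|x y] /=; rewrite ?g1 ?f1 // gM fM.
Qed.

Lemma alg_aut_inv_subproof (F : fieldType) (A : algType F) (f : alg_aut A) :
  exists g : alg_aut A, cancel f g /\ cancel g f.
Proof.
have /asboolP[fL [f1 fM] [g fK gK]] := alg_autP f.
suff gP : is_alg_aut g by exists (AlgAut gP).
apply/asboolP; split; last by exists f.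
- by move=> a x y; apply: (can_inj fK); rewrite fL !gK.
- by split=> [|x y]; apply: (can_inj fK); rewrite ?fM !gK // f1.
Qed.

Definition alg_aut_one (F : fieldType) (A : algType F) :=
  AlgAut (is_alg_aut1 A).
Definition alg_aut_mul (F : fieldType) (A : algType F) (f g : alg_aut A) :=
  AlgAut (is_alg_autM f g).
Definition alg_aut_inv (F : fieldType) (A : algType F) (f : alg_aut A) :=
  sval (cid (alg_aut_inv_subproof f)).

Lemma alg_aut_mulA (F : fieldType) (A : algType F) :
  associative (@alg_aut_mul F A).
Proof. by move=> f g h; apply: val_inj. Qed.

Lemma alg_aut_mul1 (F : fieldType) (A : algType F) :
  left_id (alg_aut_one A) (@alg_aut_mul F A).
Proof. by move=> f; apply: val_inj. Qed.

Lemma alg_aut_mulr1 (F : fieldType) (A : algType F) :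
  right_id (alg_aut_one A) (@alg_aut_mul F A).
Proof. by move=> f; apply: val_inj. Qed.

Lemma alg_aut_mulV (F : fieldType) (A : algType F) :
  left_inverse (alg_aut_one A) (@alg_aut_inv F A) (@alg_aut_mul F A).
Proof.
move=> f; apply: val_inj; apply/funext => x /=.
by rewrite /alg_aut_inv; case: cid => g [fK gK] /=; rewrite fK.
Qed.

Lemma alg_aut_mulrV (F : fieldType) (A : algType F) :
  right_inverse (alg_aut_one A) (@alg_aut_inv F A) (@alg_aut_mul F A).
Proof.
move=> f; apply: val_inj; apply/funext => x /=.
by rewrite /alg_aut_inv; case: cid => g [fK gK] /=; rewrite gK.
Qed.

HB.instance Definition _ (F : fieldType) (A : algType F) :=
  isGroup.Build (alg_aut A) (@alg_aut_mulA F A) (@alg_aut_mul1 F A)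
    (@alg_aut_mulr1 F A) (@alg_aut_mulV F A) (@alg_aut_mulrV F A).

Definition short_exact (G H K : groupType) (i : G -> H) (p : H -> K) : Prop :=
  [/\ injective i,
      forall x, p x = 1%g <-> exists y, i y = x
    & forall z, exists x, p x = z].

(* Main.v *)
Require Import Defs.
From HB Require Import structures.
From mathcomp Require Import all_boot all_order all_algebra.
From mathcomp Require Import boolp.
From mathcomp Require Import ring zify.
Import GRing.Theory.
Local Open Scope ring_scope.

(** Everything rests on two facts: the units of a quantum torus are scalar
    multiples of monomials, and the parameters are independent enough to leave
    no room for a lattice automorphism other than the identity and its opposite.

    Units.  The algebra is known only through its universal property.  That
    property makes the monomials span it ([monomial_expansion]): the span is a
    subalgebra satisfying the relations, hence a retract of the whole algebra.
    It also provides, for every character [phi] of Z^n, the automorphism scaling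
    [X^m] by [phi m] ([scalar_aut_exists]).  Independence of the parameters
    gives a scalar [t] that is not a root of unity, so that for an integer weight [w]
    the character [m |-> t ^ weight w m] turns weights into distinct
    eigenvalues, and the eigencomponents of an element can be read off
    separately ([eigencomponent0]).  Choosing
    [w] injective on the supports of a unit and of its inverse
    ([separating_weight]), the two terms of highest weight multiply to a nonzero
    component of 1, and so do those of lowest weight; the weights in the support
    of the unit are then all equal, and the unit has one term
    ([unit_monomial]).

    Consequently an automorphism sends [X^m] to a scalar multiple of
    [X^(s *m m)] for a unique integer matrix [s], which is invertible and
    preserves the commutation form ([induced_lambda_preserving]).

    Rigidity.  Since the nontrivial [q i j], [i < j], are independent, a matrix
    preserves the form iff it preserves, for each such pair, the 2 x 2 minor of
    coordinates [i] and [j], that is, iff its rows satisfy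
    [r_i /\ r_j = e_i /\ e_j].  Then [r_i] lies in the plane spanned by [e_i]
    and [e_j] for every partner [j] of [i].  Every index has two partners, so
    [r_i] is a multiple of [e_i]; the multipliers of partners have product 1 in
    Z, and the last index is a partner of all the others, so the matrix is 1 or
    -1 ([lambda_rigid]).  The value -1 is induced by [X_i |-> X_i^-1], and the
    automorphisms inducing 1 are the scalar ones. *)

Set Implicit Arguments.
Unset Strict Implicit.
Unset Printing Implicit Defensive.

(** * Commutation up to a scalar *)

Section ScalarCommutation.
Variables (F : fieldType) (B : unitAlgType F).
Implicit Types (x y z : B) (c : F).

Definition proportional x y := exists2 c, c != 0 & x = c *: y.

Lemma proportional_refl x : proportional x x.
Proof. by exists 1; rewrite ?oner_neq0 ?scale1r. Qed.

Lemma proportional_trans {x z} y :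
  proportional x y -> proportional y z -> proportional x z.
Proof.
move=> [c c0 ->] [d d0 ->]; exists (c * d); first exact: mulf_neq0.
by rewrite scalerA.
Qed.

Lemma proportional_sym x y : proportional x y -> proportional y x.
Proof.
by move=> [c c0 ->]; exists c^-1; rewrite ?invr_eq0 // scalerK.
Qed.

Lemma proportionalM x x' y y' :
  proportional x x' -> proportional y y' -> proportional (x * y) (x' * y').
Proof.
move=> [c c0 ->] [d d0 ->]; exists (c * d); first exact: mulf_neq0.
by rewrite -scalerAl -scalerAr scalerA.
Qed.

Lemma scaler_unit_inj x c d : x \is a GRing.unit -> c *: x = d *: x -> c = d.
Proof.
move=> ux /(congr1 (fun z => z * x^-1)); rewrite -!scalerAl divrr //.
move/eqP; rewrite -subr_eq0 -scalerBl scaler_eq0 oner_eq0 orbF subr_eq0.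
by move/eqP.
Qed.

Definition qcommute c x y := x * y = c *: (y * x).

Lemma qcommute_sym c x y : c != 0 -> qcommute c x y -> qcommute c^-1 y x.
Proof. by rewrite /qcommute => c0 ->; rewrite scalerK. Qed.

Lemma qcommuteXz c x y (k : int) :
  c != 0 -> x \is a GRing.unit -> qcommute c x y -> qcommute (c ^ k) (x ^ k) y.
Proof.
have qX d z (n : nat) : qcommute d z y -> qcommute (d ^+ n) (z ^+ n) y.
  rewrite /qcommute => dz; elim: n => [|n IHn].
    by rewrite !expr0 mul1r mulr1 scale1r.
  rewrite !exprS -mulrA IHn -scalerAr [z * (y * _)]mulrA dz.
  by rewrite -scalerAl scalerA -mulrA [d * _]mulrC.
rewrite {2}/qcommute => c0 ux xy; case: k => n; first exact: qX.
rewrite NegzE -!exprz_inv; apply: qX; rewrite /qcommute.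
apply: (mulrI ux); rewrite -scalerAr !mulrA mulrV // mul1r xy -scalerAl.
by rewrite scalerK // mulrK.
Qed.

Lemma qcommute_prodl (I : Type) (s : seq I) (u : I -> B) (c : I -> F) y :
  (forall i, qcommute (c i) (u i) y) ->
  qcommute (\prod_(i <- s) c i) (\prod_(i <- s) u i) y.
Proof.
rewrite /qcommute => uy; elim: s => [|i s IHs].
  by rewrite !big_nil mul1r mulr1 scale1r.
rewrite !big_cons -mulrA IHs -scalerAr [u i * (y * _)]mulrA uy.
rewrite -scalerAl scalerA -mulrA.
by rewrite [c i * _]mulrC.
Qed.

Lemma qcommute_prodr (I : Type) (s : seq I) (u : I -> B) (c : I -> F) y :
  (forall i, qcommute (c i) y (u i)) ->
  qcommute (\prod_(i <- s) c i) y (\prod_(i <- s) u i).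
Proof.
rewrite /qcommute => uy; elim: s => [|i s IHs].
  by rewrite !big_nil mul1r mulr1 scale1r.
rewrite !big_cons [y * (u i * _)]mulrA uy -scalerAl -[u i * y * _]mulrA IHs.
by rewrite -scalerAr scalerA mulrA.
Qed.

(** The scalar is left implicit: it is a product of the [c i j] over the pairs
    that get exchanged, and only its being nonzero matters. *)
Lemma prod_split_proportional (I : Type) (s : seq I) (u v : I -> B)
    (c : I -> I -> F) :
  (forall i j, c i j != 0) -> (forall i j, qcommute (c i j) (v i) (u j)) ->
  proportional (\prod_(i <- s) (u i * v i))
    (\prod_(i <- s) u i * \prod_(i <- s) v i).
Proof.
move=> c0 vu; elim: s => [|i s IHs].
  by rewrite !big_nil mulr1; apply: proportional_refl.
rewrite !big_cons.
apply: proportional_trans (proportionalM (proportional_refl _) IHs) _.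
have vU := qcommute_prodr s (vu i).
rewrite -!mulrA; apply: proportionalM; first exact: proportional_refl.
rewrite !mulrA; apply: proportionalM; last exact: proportional_refl.
exists (\prod_(j <- s) c i j) => //.
by elim/big_ind: _ => *; rewrite ?oner_neq0 ?mulf_neq0.
Qed.

End ScalarCommutation.

Section MonomialCalculus.
Variables (F : fieldType) (n : nat) (q : 'M[F]_n) (B : unitAlgType F).
Variable (Y : 'I_n -> B).
Hypothesis q_anti : mult_antisymmetric q.
Hypothesis Y_rel : torus_relations q Y.
Implicit Types m : 'cV[int]_n.

(** The form of the quantum torus with values in the field, so that it can be
    computed from the parameters; [torus_lambdaE] relates it to the commutator
    of monomials. *)
Definition lambda_value m m' : F :=
  \prod_(i < n) \prod_(j < n) q i j ^ (m i 0 * m' j 0).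

Let q_neq0 i j : q i j != 0. Proof. by case: q_anti. Qed.

Lemma lambda_value_neq0 m m' : lambda_value m m' != 0.
Proof.
by apply/prodf_neq0 => i _; apply/prodf_neq0 => j _; rewrite expfz_neq0.
Qed.

Lemma torus_power_unit i (k : int) : Y i ^ k \is a GRing.unit.
Proof. by apply: unitrXz; case: Y_rel. Qed.

Lemma monomial_unit m : monomial Y m \is a GRing.unit.
Proof.
rewrite /monomial; elim/big_ind: _ => [|x y ux uy|i _]; first exact: unitr1.
  by rewrite unitrMl.
exact: torus_power_unit.
Qed.

Lemma torus_power_qcommute i j (k l : int) :
  qcommute (q i j ^ (k * l)) (Y i ^ k) (Y j ^ l).
Proof.
case: Y_rel => uY relY; rewrite mulrC -exprz_exp.
apply: qcommuteXz => //; first by rewrite expfz_neq0.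
have qji : q j i = (q i j)^-1 by case: q_anti.
have -> : q i j ^ l = (q j i ^ l)^-1 by rewrite qji exprz_inv -invr_expz invrK.
by apply: qcommute_sym; [rewrite expfz_neq0 | apply: qcommuteXz].
Qed.

Lemma monomial_qcommute m m' :
  qcommute (lambda_value m m') (monomial Y m) (monomial Y m').
Proof.
apply: qcommute_prodl => i; apply: qcommute_prodr => j.
exact: torus_power_qcommute.
Qed.

Lemma monomialD_proportional m m' :
  proportional (monomial Y (m + m')) (monomial Y m * monomial Y m').
Proof.
have -> : monomial Y (m + m') = \prod_(i < n) (Y i ^ m i 0 * Y i ^ m' i 0).
  by apply: eq_bigr => i _; rewrite mxE exprzDr //; case: Y_rel.
apply: (@prod_split_proportional _ _ _ _ _ _
  (fun i j => q i j ^ (m' i 0 * m j 0))) => i j; first by rewrite expfz_neq0.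
exact: torus_power_qcommute.
Qed.

Lemma monomial0 : monomial Y 0 = 1.
Proof. by rewrite /monomial big1 // => i _; rewrite mxE expr0z. Qed.

Lemma monomial_delta i : monomial Y (delta_mx i 0) = Y i.
Proof.
have pow j : Y j ^ (delta_mx i 0 : 'cV[int]_n) j 0 = if j == i then Y i else 1.
  by rewrite mxE andbT; case: eqP => [->|_]; rewrite ?expr1z ?expr0z.
rewrite /monomial (eq_bigr _ (fun j _ => pow j)) -big_mkcond /=.
by rewrite big_pred1_eq.
Qed.

Lemma torus_lambdaE m m' : torus_lambda Y m m' = (lambda_value m m')%:A.
Proof.
rewrite /torus_lambda monomial_qcommute -!scalerAl mulrK ?monomial_unit //.
by rewrite divrr ?monomial_unit.
Qed.

End MonomialCalculus.

(** * Consequences of the universal property *)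

Section SubalgebraType.
Variables (F : fieldType) (A : unitAlgType F) (S : {pred A}).
Hypothesis S_closed : GRing.subalg_closed S.

(** The closure proof is a parameter of the type so that its algebra structure
    can be found by inference.  The type must carry inverses of its own to be a
    test object for the universal property, and they are chosen inside the
    subalgebra, which need not be closed under the inverses of the ambient
    algebra. *)
Record subalg_of (clS : GRing.subalg_closed S) :=
  SubAlg { subalg_val : A; _ : subalg_val \in S }.

Local Notation T := (subalg_of S_closed).

HB.instance Definition _ := [isSub for @subalg_val S_closed].
HB.instance Definition _ := [Choice of T by <:].
HB.instance Definition _ :=
  GRing.SubChoice_isSubAlgebra.Build F A S T
    (GRing.subalg_closed_semi S_closed).

Definition subalg_invertible (x : T) := exists y : T, y * x = 1 /\ x * y = 1.

Definition subalg_inv (x : T) : T :=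
  if pselect (subalg_invertible x) is left e then sval (cid e) else x.

Lemma subalg_mulVr : {in [pred x | `[< subalg_invertible x >]],
  left_inverse 1 subalg_inv *%R}.
Proof.
move=> x /asboolP ux; rewrite /subalg_inv; case: pselect => // e.
by case: cid => y [].
Qed.

Lemma subalg_mulrV : {in [pred x | `[< subalg_invertible x >]],
  right_inverse 1 subalg_inv *%R}.
Proof.
move=> x /asboolP ux; rewrite /subalg_inv; case: pselect => // e.
by case: cid => y [].
Qed.

Lemma subalg_unitP (x y : T) :
  y * x = 1 /\ x * y = 1 -> [pred x | `[< subalg_invertible x >]] x.
Proof. by move=> xy; apply/asboolP; exists y. Qed.

Lemma subalg_inv_out :
  {in [predC [pred x | `[< subalg_invertible x >]]], subalg_inv =1 id}.
Proof.
move=> x /negP nux; rewrite /subalg_inv; case: pselect => // e.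
by case: nux; apply/asboolP.
Qed.

HB.instance Definition _ := GRing.NzRing_hasMulInverse.Build T
  subalg_mulVr subalg_mulrV subalg_unitP subalg_inv_out.

Lemma subalg_val_linear : linear (@subalg_val S_closed : T -> A).
Proof. exact: (linearP (\val : T -> A)). Qed.

Lemma subalg_val_monoid_morphism :
  monoid_morphism (@subalg_val S_closed : T -> A).
Proof.
split=> [|x y]; first exact: (rmorph1 (\val : T -> A)).
exact: (rmorphM (\val : T -> A)).
Qed.

HB.instance Definition _ := GRing.isLinear.Build F T A *:%R
  (@subalg_val S_closed) subalg_val_linear.
HB.instance Definition _ := GRing.isMonoidMorphism.Build T A
  (@subalg_val S_closed) subalg_val_monoid_morphism.

End SubalgebraType.

Section UniversalProperty.
Variables (F : fieldType) (n : nat) (q : 'M[F]_n) (A : unitAlgType F).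
Variable (X : 'I_n -> A).
Hypothesis torusA : is_quantum_torus q X.

Lemma torus_endo_ext (f g : {lrmorphism A -> A}) :
  (forall i, f (X i) = g (X i)) -> f =1 g.
Proof.
move=> fg; case: torusA => relX univ.
have [uX relX'] := relX.
have relg : torus_relations q (fun i => g (X i)).
  split=> [i|i j]; first exact: rmorph_unit.
  by rewrite -!rmorphM relX'; apply: linearZ.
have [h _ hu] := univ _ _ relg.
by move=> x; rewrite (hu f) // (hu g).
Qed.

(** The map given by the universal property followed by [iota] fixes the
    generators, so it is the identity. *)
Lemma torus_retraction (B : unitAlgType F) (iota : {lrmorphism B -> A})
    (Y : 'I_n -> B) :
  torus_relations q Y -> (forall i, iota (Y i) = X i) ->
  forall x, exists y, iota y = x.
Proof.
move=> relY iY x; case: (torusA) => _ univ; have [f fX _] := univ B Y relY.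
exists (f x); apply: (@torus_endo_ext (iota \o f) idfun) => i /=.
by rewrite fX.
Qed.

(** The inverses of the generators have to be assumed in the subalgebra for the
    generators to be invertible there. *)
Lemma torus_generated (S : {pred A}) : GRing.subalg_closed S ->
  (forall i, X i \in S) -> (forall i, (X i)^-1 \in S) -> forall x, x \in S.
Proof.
move=> clS XS XVS x; case: (torusA) => -[uX relX] univ.
pose T : unitAlgType F := subalg_of clS.
pose Y i : T := SubAlg clS (XS i).
have relY : torus_relations q Y.
  split=> [i|i j]; last by apply: val_inj; rewrite /= relX.
  apply/GRing.unitrP; exists (SubAlg clS (XVS i) : T).
  by split; apply: val_inj; rewrite /= ?mulVr ?divrr.
have [y <-] := torus_retraction (iota := @subalg_val F A S clS) relY
  (fun=> erefl) x.
by case: y.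
Qed.

(** The endomorphisms [X_i |-> Y_i] and [X_i |-> Z_i] are mutually inverse as
    soon as they are so on generators. *)
Lemma torus_alg_aut (Y Z : 'I_n -> A) :
  torus_relations q Y -> torus_relations q Z ->
  (forall f : {lrmorphism A -> A}, (forall i, f (X i) = Y i) ->
     forall i, f (Z i) = X i) ->
  (forall f : {lrmorphism A -> A}, (forall i, f (X i) = Z i) ->
     forall i, f (Y i) = X i) ->
  exists theta : alg_aut A, forall i, theta (X i) = Y i.
Proof.
case: (torusA) => _ univ relY relZ YZ ZY.
have [f fX _] := univ A Y relY; have [g gX _] := univ A Z relZ.
have fgK : cancel g f.
  by apply: (@torus_endo_ext (f \o g) idfun) => i /=; rewrite gX YZ.
have gfK : cancel f g.
  by apply: (@torus_endo_ext (g \o f) idfun) => i /=; rewrite fX ZY.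
suff fP : is_alg_aut f by exists (AlgAut fP).
apply/asboolP; split; last by exists g.
- by move=> a x y; rewrite linearP.
- by split; [apply: rmorph1 | apply: rmorphM].
Qed.

End UniversalProperty.

(** * Weights on the lattice *)

Lemma int_vector_ind n (P : 'cV[int]_n -> Prop) :
  P 0 -> (forall i, P (delta_mx i 0)) ->
  (forall m m', P m -> P m' -> P (m + m')) -> (forall m, P m -> P (- m)) ->
  forall m, P m.
Proof.
move=> P0 Pe PD PN m; rewrite [m]matrix_sum_delta.
elim/big_ind: _ => // i _; rewrite big_ord1.
have PX (k : nat) : P (k%:Z *: delta_mx i 0).
  elim: k => [|k IHk]; first by rewrite scale0r.
  by rewrite intS scalerDl scale1r; apply: PD.
by case: (m i 0) => k; rewrite ?NegzE ?scaleNr; [apply: PX | apply/PN/PX].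
Qed.

Section Weights.
Variable n : nat.
Implicit Types (w : 'I_n -> int) (m : 'cV[int]_n).

Definition weight w m : int := \sum_(i < n) w i * m i 0.

Lemma weightD w : {morph weight w : m m' / m + m'}.
Proof.
move=> m m'; rewrite /weight -big_split /=.
by apply: eq_bigr => i _; rewrite mxE mulrDr.
Qed.

Lemma weightN w m : weight (fun i => - w i) m = - weight w m.
Proof. by rewrite /weight -sumrN; apply: eq_bigr => i _; rewrite mulNr. Qed.

Lemma poly_nonroot (p : {poly int}) : p != 0 -> exists N : nat, p.[N%:Z] != 0.
Proof.
move=> p0; apply/not_existsP => allroot.
have roots : all (root p) [seq Posz k | k <- iota 0 (size p)].
  by apply/allP => _ /mapP[k _ ->]; apply/negPn/negP => pk; apply: (allroot k).
have uniq_s : uniq [seq Posz k | k <- iota 0 (size p)].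
  by rewrite map_inj_uniq ?iota_uniq // => i j [].
by have := max_poly_roots p0 roots uniq_s; rewrite size_map size_iota ltnn.
Qed.

(** With the weights [N ^+ i], two vectors collide only if [N] is a root of the
    nonzero polynomial whose coefficients are the coordinates of their
    difference; a natural number avoids the roots of finitely many such
    polynomials. *)
Lemma separating_weight (s : seq 'cV[int]_n) :
  exists w, {in s &, injective (weight w)}.
Proof.
(* [insub] turns the exponent into a coordinate; its default 0 is never met. *)
pose d m m' : {poly int} :=
  \poly_(i < n) (oapp (fun i => (m - m') i 0) 0 (insub i)).
have dE m m' i : (d m m')`_(val i) = (m - m') i 0.
  by rewrite coef_poly ltn_ord valK.
pose P := \prod_(p <- [seq (m, m') | m <- s, m' <- s] | p.1 != p.2) d p.1 p.2.
have [N PN] : exists N : nat, P.[N%:Z] != 0.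
  apply: poly_nonroot; rewrite prodf_seq_neq0; apply/allP => -[m m'] _ /=.
  apply/implyP; apply: contra_neq => d0; apply/colP => i.
  have := dE m m' i; rewrite d0 coef0 !mxE => mm'i.
  by apply/eqP; rewrite -subr_eq0 -mm'i.
exists (fun i => N%:Z ^+ i) => m m' ms m's wmm'; apply/eqP/negPn/negP => mm'.
move: PN; rewrite horner_prod prodf_seq_neq0 => /allP/(_ (m, m')).
rewrite mm' /= => /(_ (allpairs_f _ ms m's))/eqP; apply.
transitivity (weight (fun i => N%:Z ^+ i) m - weight (fun i => N%:Z ^+ i) m').
  rewrite horner_poly /weight -sumrB; apply: eq_bigr => i _.
  by rewrite valK /= !mxE mulrC mulrBr.
by rewrite wmm' subrr.
Qed.

Lemma max_weight w (D : seq 'cV[int]_n) : D != [::] ->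
  exists2 m, m \in D & forall m', m' \in D -> (weight w m' <= weight w m)%R.
Proof.
elim: D => // m [|m' D] IH _.
  by exists m; rewrite ?mem_head // => m'; rewrite inE => /eqP->.
have [//|m1 m1D m1max] := IH.
have [le1|/Order.POrderTheory.ltW le1] :=
  Order.TotalTheory.leP (weight w m) (weight w m1).
  exists m1; first by rewrite inE m1D orbT.
  by move=> m2; rewrite inE => /predU1P[->|/m1max].
exists m; first by rewrite mem_head.
move=> m2; rewrite inE => /predU1P[->//|/m1max].
by move/Order.POrderTheory.le_trans; apply.
Qed.

End Weights.

(** * Eigencomponents of an automorphism *)

Section AlgebraAutomorphisms.
Variables (F : fieldType) (A : unitAlgType F).

Lemma alg_aut_linear (theta : alg_aut A) : linear theta.
Proof. by case/asboolP: (alg_autP theta). Qed.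

Lemma alg_aut_monoid_morphism (theta : alg_aut A) : monoid_morphism theta.
Proof. by case/asboolP: (alg_autP theta). Qed.

HB.instance Definition _ (theta : alg_aut A) :=
  GRing.isLinear.Build F A A *:%R theta (alg_aut_linear theta).
HB.instance Definition _ (theta : alg_aut A) :=
  GRing.isMonoidMorphism.Build A A theta (alg_aut_monoid_morphism theta).

(** Apply [p] evaluated at [theta] to the equation [\sum_i w i = z]; the proof
    follows the Horner scheme instead of naming the powers of [theta]. *)
Lemma eigenvector_poly (theta : alg_aut A) (I : Type) (s : seq I) (mu : I -> F)
    (w : I -> A) (z : A) (p : {poly F}) :
  (forall i, theta (w i) = mu i *: w i) -> theta z = z ->
  \sum_(i <- s) w i = z -> \sum_(i <- s) p.[mu i] *: w i = p.[1] *: z.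
Proof.
move=> thw thz sw; elim/poly_ind: p => [|p c IHp].
  by rewrite horner0 scale0r big1 // => i _; rewrite horner0 scale0r.
have := congr1 theta IHp; rewrite linearZ /= thz linear_sum => thIH.
rewrite hornerMXaddC mulr1 scalerDl -thIH -sw scaler_sumr -big_split /=.
apply: eq_bigr => i _.
by rewrite hornerMXaddC scalerDl linearZ /= thw scalerA.
Qed.

(** A decomposition of a fixed vector into eigenvectors of eigenvalues [t ^ e i]
    has no component of nonzero exponent [k]: evaluate at [theta] a polynomial
    vanishing at 1 and at every occurring [t ^ j] except [t ^ k]. *)
Lemma eigencomponent0 (theta : alg_aut A) (t : F) (I : eqType) (s : seq I)
    (e : I -> int) (w : I -> A) (z : A) (k : int) :
  t != 0 -> (forall j : int, t ^ j = 1 -> j = 0) ->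
  (forall i, theta (w i) = t ^ e i *: w i) -> theta z = z ->
  \sum_(i <- s) w i = z -> k != 0 -> \sum_(i <- s | e i == k) w i = 0.
Proof.
move=> t0 t_free thw thz sw k0.
have t_inj i j : t ^ i = t ^ j -> i = j.
  move=> tij; apply/eqP; rewrite -subr_eq0; apply/eqP/t_free.
  by rewrite expfzDr // tij -expfzDr // subrr expr0z.
(* The leading 0 puts the eigenvalue 1 of [z] among the roots. *)
pose p := \prod_(j <- 0 :: [seq e i | i <- s] | j != k) ('X - (t ^ j)%:P).
have p_root j : j \in 0 :: [seq e i | i <- s] -> j != k -> p.[t ^ j] = 0.
  move=> js jk; apply/eqP; rewrite horner_prod prodf_seq_eq0.
  by apply/hasP; exists j; rewrite // jk hornerXsubC subrr eqxx.
have pk : p.[t ^ k] != 0.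
  rewrite horner_prod prodf_seq_neq0; apply/allP => j _; apply/implyP => jk.
  by rewrite hornerXsubC subr_eq0; apply: contra_neq jk => /t_inj.
have := eigenvector_poly p thw thz sw.
rewrite -{1}(expr0z t) p_root ?mem_head // 1?eq_sym // scale0r.
rewrite (bigID (fun i => e i == k)) /= [X in _ + X]big1_seq ?addr0; last first.
  move=> i /andP[ek si]; rewrite p_root ?scale0r //.
  by rewrite inE map_f ?orbT.
rewrite (eq_bigr (fun i => p.[t ^ k] *: w i)) => [|i /eqP-> //].
by rewrite -scaler_sumr => /eqP; rewrite scaler_eq0 (negPf pk) => /eqP.
Qed.

End AlgebraAutomorphisms.


(** * Units of the quantum torus and induced matrices *)

Section ZHomTheory.
Variables (F : fieldType) (n : nat).
Implicit Types phi : zhom F n.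

Lemma zhom_neq0 phi m : phi m != 0.
Proof. by case/asboolP: (zhomP phi). Qed.

Lemma zhomD phi m m' : phi (m + m') = phi m * phi m'.
Proof. by case/asboolP: (zhomP phi). Qed.

Lemma zhom0 phi : phi 0 = 1.
Proof. by apply: (mulfI (zhom_neq0 phi 0)); rewrite -zhomD addr0 mulr1. Qed.

Lemma zhomN phi m : phi (- m) = (phi m)^-1.
Proof.
apply: (mulfI (zhom_neq0 phi m)).
by rewrite -zhomD subrr zhom0 divff ?zhom_neq0.
Qed.

Lemma zhom_weight (t : F) (w : 'I_n -> int) : t != 0 ->
  exists phi, forall m, phi m = t ^ weight w m.
Proof.
move=> t0; suff phiP : is_zhom (fun m => t ^ weight w m) by exists (ZHom phiP).
by apply/asboolP; split=> [m|m m']; rewrite ?expfz_neq0 // weightD expfzDr.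
Qed.

End ZHomTheory.

Lemma ler_eq_add (a a' b b' : int) :
  (a <= a')%R -> (b <= b')%R -> a + b = a' + b' -> a = a' /\ b = b'.
Proof. by move=> *; split; lia. Qed.

Lemma squeezed_weight (x x1 x2 x3 x4 : int) :
  x1 + x2 = 0 -> - x3 + - x4 = 0 -> (x <= x1)%R -> (- x <= - x3)%R ->
  (x4 <= x2)%R -> x = x1.
Proof. by lia. Qed.

Section QuantumTorus.
Variables (F : fieldType) (n : nat) (q : 'M[F]_n) (A : unitAlgType F).
Variable (X : 'I_n -> A).
Hypothesis q_anti : mult_antisymmetric q.
Hypothesis torusA : is_quantum_torus q X.

Let X_rel : torus_relations q X. Proof. by case: torusA. Qed.
Let X_unit i : X i \is a GRing.unit. Proof. by case: X_rel. Qed.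
Let mono_unit m : monomial X m \is a GRing.unit.
Proof. exact: monomial_unit X_rel m. Qed.

Lemma torus_alg_aut_ext (theta eta : alg_aut A) :
  (forall i, theta (X i) = eta (X i)) -> theta = eta.
Proof.
move=> te; apply: val_inj; apply/funext => x.
exact: (torus_endo_ext torusA (f := theta) (g := eta)).
Qed.

Lemma monomialN_proportional m :
  proportional (monomial X (- m)) (monomial X m)^-1.
Proof.
have [c c0] := monomialD_proportional q_anti X_rel m (- m).
rewrite subrr monomial0 => E; exists c^-1; first by rewrite invr_eq0.
by apply: (mulrI (mono_unit m)); rewrite -scalerAr mulrV // E scalerK.
Qed.

(** On generators this is the universal property.  It extends to all monomials
    because the scalar relating [X^(m + m')] to [X^m * X^m'] is fixed by any
    automorphism. *)
Lemma scalar_aut_exists (phi : zhom F n) : exists theta : alg_aut A,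
  forall m, theta (monomial X m) = phi m *: monomial X m.
Proof.
have rel_scale (c : 'I_n -> F) : (forall i, c i != 0) ->
    torus_relations q (fun i => c i *: X i).
  move=> c0; split=> [i|i j].
    by rewrite -mulr_algl unitrMl // scaler_unit ?unitr1 // unitfE.
  case: X_rel => _ rel; rewrite -!scalerAl -!scalerAr rel !scalerA.
  by congr (_ *: _); ring.
pose e i : 'cV[int]_n := delta_mx i 0.
have phie0 i : phi (e i) != 0 by apply: zhom_neq0.
have phieV0 i : (phi (e i))^-1 != 0 by rewrite invr_eq0.
have [||theta thX] := torus_alg_aut torusA (rel_scale _ phie0)
    (rel_scale _ phieV0).
- by move=> f fX i; rewrite linearZ /= fX scalerK.
- by move=> f fX i; rewrite linearZ /= fX scalerA divff // scale1r.
exists theta; apply: int_vector_ind => [|i|m m' IH IH'|m IH].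
- by rewrite monomial0 zhom0 scale1r rmorph1.
- by rewrite monomial_delta thX.
- have [c c0 ->] := monomialD_proportional q_anti X_rel m m'.
  rewrite linearZ rmorphM /= IH IH' -scalerAl -scalerAr zhomD !scalerA.
  by congr (_ *: _); ring.
- have [c c0 ->] := monomialN_proportional m.
  rewrite linearZ rmorphV //= IH zhomN invrZ ?unitfE ?zhom_neq0 // !scalerA.
  by congr (_ *: _); rewrite mulrC.
Qed.

Definition has_expansion (x : A) := exists D : seq (F * 'cV[int]_n),
  x = \sum_(p <- D) p.1 *: monomial X p.2.

(** Products of monomials are monomials up to a scalar, so their span is a
    subalgebra; it contains the generators and their inverses. *)
Lemma monomial_expansion (x : A) : has_expansion x.
Proof.
have expM m m' c : has_expansion (c *: (monomial X m * monomial X m')).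
  have [d d0 ->] := proportional_sym (monomialD_proportional q_anti X_rel m m').
  by exists [:: (c * d, m + m')]; rewrite big_seq1 scalerA.
have expD y z : has_expansion y -> has_expansion z -> has_expansion (y + z).
  by move=> [D ->] [E ->]; exists (D ++ E); rewrite big_cat.
have exp0 : has_expansion 0 by exists [::]; rewrite big_nil.
have exp_mono m c : has_expansion (c *: monomial X m).
  by exists [:: (c, m)]; rewrite big_seq1.
pose S : {pred A} := fun y => `[< has_expansion y >].
have SP y : reflect (has_expansion y) (y \in S) := asboolP _.
apply/SP; move: x.
apply: (torus_generated torusA).
- split; first by apply/SP; rewrite -(monomial0 X) -[monomial _ _]scale1r.
    move=> c y z /SP[D ->] /SP zE; apply/SP/expD => //.
    by rewrite scaler_sumr; elim/big_ind: _ => // p _; rewrite scalerA.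
  move=> y z /SP[D ->] /SP[E ->]; apply/SP.
  rewrite mulr_suml; elim/big_ind: _ => // p _.
  rewrite mulr_sumr; elim/big_ind: _ => // r _.
  by rewrite -scalerAl -scalerAr scalerA.
- by move=> i; apply/SP; rewrite -monomial_delta -[monomial _ _]scale1r.
- move=> i; apply/SP; rewrite -(monomial_delta X).
  by have [c c0 ->] := proportional_sym (monomialN_proportional (delta_mx i 0)).
Qed.

Lemma reduced_expansion (x : A) :
  exists (D : seq 'cV[int]_n) (a : 'cV[int]_n -> F),
  [/\ uniq D, forall m, m \in D -> a m != 0
    & x = \sum_(m <- D) a m *: monomial X m].
Proof.
have [s ->] := monomial_expansion x.
pose a m := \sum_(p <- s | p.2 == m) p.1.
pose E := undup [seq p.2 | p <- s].
exists [seq m <- E | a m != 0], a; split.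
- by rewrite filter_uniq ?undup_uniq.
- by move=> m; rewrite mem_filter => /andP[].
rewrite big_filter [RHS]big_mkcond /=.
rewrite (eq_bigr
  (fun m => \sum_(p <- s | p.2 == m) p.1 *: monomial X p.2)); last first.
  move=> m _.
  rewrite (eq_bigr (fun p => p.1 *: monomial X m)) => [|p /eqP-> //].
  by rewrite -scaler_suml -/(a m); case: eqP => // ->; rewrite scale0r.
rewrite (exchange_big_dep predT) //= big_seq [RHS]big_seq.
apply: eq_bigr => p ps.
rewrite big_mkcond (bigD1_seq p.2) ?undup_uniq ?mem_undup ?map_f //= eqxx.
by rewrite big1 ?addr0 // => m; rewrite eq_sym => /negPf->.
Qed.

(** A scalar [t] of infinite order makes [t ^ weight w m] a faithful record of
    the weight of [X^m]. *)
Section FreeParameter.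
Variable t : F.
Hypothesis t_neq0 : t != 0.
Hypothesis t_free : forall k : int, t ^ k = 1 -> k = 0.

(** Among the products of a term of each factor, only that of the two top terms
    reaches the highest weight.  It is nonzero, so it cannot cancel, and it must
    lie in the weight of 1. *)
Lemma top_weight w (D E : seq 'cV[int]_n) (a b : 'cV[int]_n -> F) m1 m2 :
  uniq D -> uniq E -> {in D &, injective (weight w)} ->
  {in E &, injective (weight w)} -> m1 \in D -> m2 \in E ->
  (forall m, m \in D -> (weight w m <= weight w m1)%R) ->
  (forall m, m \in E -> (weight w m <= weight w m2)%R) ->
  a m1 != 0 -> b m2 != 0 ->
  (\sum_(m <- D) a m *: monomial X m) *
    (\sum_(m <- E) b m *: monomial X m) = 1 ->
  weight w m1 + weight w m2 = 0.
Proof.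
move=> uD uE injD injE m1D m2E max1 max2 a0 b0 DE1.
have [phi phiE] := zhom_weight w t_neq0.
have [theta thE] := scalar_aut_exists phi.
pose term p := (a p.1 *: monomial X p.1) * (b p.2 *: monomial X p.2).
pose e p := weight w p.1 + weight w p.2.
pose s := [seq (m, m') | m <- D, m' <- E].
have thterm p : theta (term p) = t ^ e p *: term p.
  rewrite /term rmorphM /= !linearZ /= !thE !phiE expfzDr //.
  rewrite -!scalerAl -!scalerAr !scalerA; congr (_ *: _).
  by move: (t ^ _) (t ^ _) => x y; ring.
have sum1 : \sum_(p <- s) term p = 1.
  rewrite -DE1 mulr_suml big_allpairs; apply: eq_bigr => m _.
  by rewrite mulr_sumr.
apply/eqP/negPn/negP => k0.
have := eigencomponent0 t_neq0 t_free thterm (rmorph1 theta) sum1 k0.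
have us : uniq s by apply: allpairs_uniq => // -[? ?] [? ?].
rewrite big_mkcond (bigD1_seq (m1, m2)) ?allpairs_f //= eqxx big1_seq ?addr0.
  rewrite /term /= -scalerAl -scalerAr scalerA => /eqP.
  rewrite scaler_eq0 mulf_eq0 (negPf a0) (negPf b0) /= => /eqP XX0.
  by have := mono_unit m1; rewrite -(unitrMl _ (mono_unit m2)) XX0 unitr0.
move=> p /andP[+ /allpairsP[[m m'] /= [mD m'E pE]]]; rewrite {}pE.
apply: contraNeq; case: (e (m, m') =P _) => [ee _|]; last by rewrite eqxx.
have := max1 m mD; have := max2 m' m'E => le2 le1.
have [em em'] := ler_eq_add le1 le2 ee.
by rewrite (injD _ _ mD m1D em) (injE _ _ m'E m2E em').
Qed.

(** Apply [top_weight] to a separating weight and to its opposite: the top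
    weights of the unit and of its inverse add up to 0, and so do the bottom
    ones.  As the bottom never exceeds the top, they coincide in each factor. *)
Lemma unit_monomial u : u \is a GRing.unit ->
  exists m, proportional u (monomial X m).
Proof.
move=> uu; have [D [a [uD a0 uE]]] := reduced_expansion u.
have [E [b [uE' b0 vE]]] := reduced_expansion u^-1.
have DE1 : (\sum_(m <- D) a m *: monomial X m) *
    (\sum_(m <- E) b m *: monomial X m) = 1 by rewrite -uE -vE divrr.
have D0 : D != [::].
  by apply: contraTneq uu => D0; rewrite uE D0 big_nil unitr0.
have E0 : E != [::].
  by apply: contraTneq uu => E0; rewrite -unitrV vE E0 big_nil unitr0.
have [w w_inj] := separating_weight (D ++ E).
pose v i := - w i.
have injD : {in D &, injective (weight w)}.
  by move=> m m' mD m'D; apply: w_inj; rewrite mem_cat ?mD ?m'D.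
have injE : {in E &, injective (weight w)}.
  by move=> m m' mE m'E; apply: w_inj; rewrite mem_cat ?mE ?m'E orbT.
have injDv : {in D &, injective (weight v)}.
  by move=> m m' mD m'D; rewrite !weightN => /oppr_inj; apply: injD.
have injEv : {in E &, injective (weight v)}.
  by move=> m m' mE m'E; rewrite !weightN => /oppr_inj; apply: injE.
have [m1 m1D max1] := max_weight w D0; have [m2 m2E max2] := max_weight w E0.
(* For the opposite weight [v], these are the terms of lowest weight. *)
have [m3 m3D max3] := max_weight v D0; have [m4 m4E max4] := max_weight v E0.
have top := top_weight uD uE' injD injE m1D m2E max1 max2
  (a0 _ m1D) (b0 _ m2E) DE1.
have bot := top_weight uD uE' injDv injEv m3D m4E max3 max4
  (a0 _ m3D) (b0 _ m4E) DE1.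
exists m1; exists (a m1); first exact: a0.
rewrite uE (bigD1_seq m1) //= big1_seq ?addr0 // => m /andP[mm1 mD].
case/eqP: mm1; apply: injD => //.
move: bot (max3 _ mD); rewrite !weightN => bot min3.
exact: (squeezed_weight top bot (max1 _ mD) min3 (max2 _ m4E)).
Qed.

Lemma monomial_proportional_inj m m' :
  proportional (monomial X m) (monomial X m') -> m = m'.
Proof.
move=> [c c0 Emm']; have [w w_inj] := separating_weight [:: m; m'].
apply: w_inj; rewrite ?inE ?eqxx ?orbT //.
have [phi phiE] := zhom_weight w t_neq0.
have [theta thE] := scalar_aut_exists phi.
have := congr1 theta Emm'; rewrite linearZ /= !thE scalerA mulrC -scalerA -Emm'.
rewrite !phiE => /(scaler_unit_inj (mono_unit m)) tw.
apply/eqP; rewrite -subr_eq0; apply/eqP/t_free.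
by rewrite expfzDr // tw -expfzDr // subrr expr0z.
Qed.

Definition induces (theta : alg_aut A) (s : 'M[int]_n) :=
  forall m, proportional (theta (monomial X m)) (monomial X (s *m m)).

Lemma induced_matrix (theta : alg_aut A) :
  exists s : 'M[int]_n, induces theta s.
Proof.
have /choice[c cP] i : exists c, proportional (theta (X i)) (monomial X c).
  by apply/unit_monomial/rmorph_unit.
exists (\matrix_(j, i) c i j 0) => m.
elim/int_vector_ind: m => [|i|m m' IH IH'|m IH].
- by rewrite mulmx0 monomial0 rmorph1; apply: proportional_refl.
- rewrite monomial_delta -colE.
  have -> : col i (\matrix_(j, i) c i j 0) = c i.
    by apply/colP => j; rewrite !mxE.
  exact: cP.
- have [d d0 ->] := monomialD_proportional q_anti X_rel m m'.
  rewrite linearZ rmorphM mulmxDr /=.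
  apply: (proportional_trans
    (y := theta (monomial X m) * theta (monomial X m'))).
    by exists d.
  apply: proportional_trans (proportionalM IH IH') _.
  exact/proportional_sym/(monomialD_proportional q_anti).
- have [d d0 ->] := monomialN_proportional m.
  rewrite linearZ rmorphV //= mulmxN.
  apply: (proportional_trans (y := (theta (monomial X m))^-1)).
    by exists d.
  apply: proportional_trans (proportional_sym (monomialN_proportional _)).
  have [d' d'0 ->] := IH; exists d'^-1; first by rewrite invr_eq0.
  by rewrite invrZ ?unitfE.
Qed.

Lemma induced_matrix_unique (theta : alg_aut A) (s s' : 'M[int]_n) :
  induces theta s -> induces theta s' -> s = s'.
Proof.
move=> sP s'P; apply/matrixP => i j.
have : s *m delta_mx j 0 = s' *m delta_mx j 0 :> 'cV_n.
  apply: monomial_proportional_inj.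
  exact: proportional_trans (proportional_sym (sP _)) (s'P _).
by rewrite -!colE => /colP/(_ i); rewrite !mxE.
Qed.

Lemma induced_matrixM (theta eta : alg_aut A) (s s' : 'M[int]_n) :
  induces theta s -> induces eta s' ->
  induces (alg_aut_mul theta eta) (s *m s').
Proof.
move=> sP s'P m /=; have [c c0 ->] := s'P m; rewrite linearZ /= -mulmxA.
by apply: proportional_trans (sP _); exists c.
Qed.

(** The matrix of the inverse automorphism is an inverse matrix.  An
    automorphism fixes scalars, in particular commutators of monomials, and the
    scalars in front of the images of the monomials cancel in a commutator. *)
Lemma induced_lambda_preserving (theta : alg_aut A) (s : 'M[int]_n) :
  induces theta s -> lambda_preserving (torus_lambda X) s.
Proof.
move=> sP; apply/andP; split.
  have [s' s'P] := induced_matrix (alg_aut_inv theta).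
  have := induced_matrixM sP s'P.
  rewrite (alg_aut_mulrV theta) => ss'P.
  suff: s *m s' = 1%:M by move/mulmx1_unit; case.
  apply: (induced_matrix_unique ss'P) => m /=; rewrite mul1mx.
  exact: proportional_refl.
apply/asboolP => m m'; rewrite !(torus_lambdaE q_anti X_rel); congr (_ *: _).
have [c c0 cE] := sP m; have [d d0 dE] := sP m'.
apply: (@scaler_unit_inj _ _ (theta (monomial X m' * monomial X m))).
  by apply: rmorph_unit; rewrite unitrMl.
have /(congr1 theta) := monomial_qcommute q_anti X_rel m m'.
rewrite linearZ /= => <-; rewrite !rmorphM /= cE dE.
rewrite -!scalerAl -!scalerAr !scalerA.
rewrite (monomial_qcommute q_anti X_rel (s *m m)) !scalerA.
by congr (_ *: _); ring.
Qed.

End FreeParameter.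

Lemma inversion_aut :
  exists theta : alg_aut A, forall i, theta (X i) = (X i)^-1.
Proof.
have relV : torus_relations q (fun i => (X i)^-1).
  split=> [i|i j]; first by rewrite unitrV.
  by have := torus_power_qcommute q_anti X_rel i j (-1) (-1).
apply: (torus_alg_aut torusA relV relV) => f fX i;
  by rewrite rmorphV //= fX invrK.
Qed.

End QuantumTorus.

(** * Rigidity of the commutation form *)

Lemma int_mul_eq1 (x y : int) : x * y = 1 -> x = y /\ (x = 1 \/ x = -1).
Proof.
move=> xy1; have : x \is a GRing.unit by apply/unitrPr; exists y.
by move=> /orP[] /eqP xE; move: xy1; rewrite xE; split; lia.
Qed.

Section Rigidity.
Variables (F : fieldType) (n : nat) (q : 'M[F]_n).
Hypothesis n_ge4 : (4 <= n)%N.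
Hypothesis q_anti : mult_antisymmetric q.

Definition free_pair (p : 'I_n * 'I_n) :=
  (p.1 < p.2)%N && ~~ ((p.1 == 0%N :> nat) && (p.2 + 2 < n)%N).

Hypothesis q_row1 : forall i j : 'I_n,
  i = 0%N :> nat -> (j + 2 < n)%N -> q i j = 1.
Hypothesis q_indep : mult_independent free_pair
  (fun p : 'I_n * 'I_n => q p.1 p.2).

Definition minor (m m' : 'cV[int]_n) (i j : 'I_n) : int :=
  m i 0 * m' j 0 - m j 0 * m' i 0.

(** Gather the exponents of [q i j] and of its inverse [q j i]; the diagonal
    parameters and those of the first row outside [free_pair] equal 1. *)
Lemma lambda_value_minors m m' :
  lambda_value q m m' =
  \prod_(p | free_pair p) q p.1 p.2 ^ minor m m' p.1 p.2.
Proof.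
have [q0 qii qji] := q_anti.
rewrite /lambda_value pair_big /=.
rewrite (bigID (fun p : 'I_n * 'I_n => p.1 < p.2)%N) /=.
rewrite [X in _ * X](bigID (fun p : 'I_n * 'I_n => p.2 < p.1)%N) /=.
rewrite [X in _ * (_ * X)]big1 ?mulr1; last first.
  move=> [i j] /=; rewrite -!leqNgt -eqn_leq eq_sym => /eqP/val_inj->.
  by rewrite qii exp1rz.
have swapK : involutive (fun p : 'I_n * 'I_n => (p.2, p.1)) by case.
rewrite [X in _ * X](reindex_inj (inv_inj swapK)) /=.
rewrite [X in _ * X](eq_bigl (fun p : 'I_n * 'I_n => p.1 < p.2)%N); last first.
  by move=> p /=; case: ltngtP.
rewrite -big_split [RHS]big_mkcond [LHS]big_mkcond /=.
apply: eq_bigr => -[i j] _ /=; rewrite /free_pair /=.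
case: ifP => //= ij; rewrite (qji i j) exprz_inv -expfzDr //.
rewrite (_ : _ + _ = minor m m' i j); last by rewrite /minor; ring.
by case: andP => //= -[/eqP i0 jn]; rewrite q_row1 // exp1rz.
Qed.

Definition linked i j := free_pair (i, j) || free_pair (j, i).

(** Independence turns an equality of values of the form into the equality of
    all the exponents. *)
Lemma lambda_preserving_minors (s : 'M[int]_n) :
  (forall m m', lambda_value q (s *m m) (s *m m') = lambda_value q m m') ->
  forall i j, linked i j ->
  forall m m', minor (s *m m) (s *m m') i j = minor m m' i j.
Proof.
move=> sP.
suff free_minor i j m m' : free_pair (i, j) ->
    minor (s *m m) (s *m m') i j = minor m m' i j.
  move=> i j /orP[ij|ji] m m'; first exact: free_minor.
  have antisym a b : minor a b i j = - minor a b j i by rewrite /minor opprB.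
  by rewrite !antisym free_minor.
move=> ij; apply/eqP; rewrite -subr_eq0; apply/eqP; have [q0 q_free] := q_indep.
apply: (q_free (fun p => minor (s *m m) (s *m m') p.1 p.2 - minor m m' p.1 p.2)
   _ (i, j) ij).
rewrite (eq_bigr (fun p => q p.1 p.2 ^ minor (s *m m) (s *m m') p.1 p.2
    / q p.1 p.2 ^ minor m m' p.1 p.2)); last first.
  by move=> p /q0 qp; rewrite expfzDr // invr_expz.
rewrite prodf_div -!lambda_value_minors sP divff //.
exact: lambda_value_neq0.
Qed.

(** Rows [i] and [j] of [s] span the same plane as [e_i] and [e_j].  Explicitly,
    by Cramer's rule, [s i c] is a combination of the minors of these rows in
    columns [(c, j)] and [(c, i)], which vanish, because the minor in columns
    [(i, j)] is 1. *)
Lemma minor_preserving_entry (s : 'M[int]_n) i j c :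
  (forall m m', minor (s *m m) (s *m m') i j = minor m m' i j) ->
  i != j -> c != i -> c != j -> s i c = 0.
Proof.
move=> sP ij ci cj.
have entry a b : s i a * s j b - s j a * s i b =
    (i == a)%:R * (j == b)%:R - (j == a)%:R * (i == b)%:R.
  have := sP (delta_mx a 0) (delta_mx b 0).
  by rewrite /minor -!colE !mxE !andbT.
have := entry i j; have := entry c i; have := entry c j.
rewrite !eqxx ![_ == c]eq_sym (negPf ci) (negPf cj).
rewrite [j == i]eq_sym (negPf ij) /=.
move=> cj0 ci0 ij1.
have -> : s i c = s i c * (s i i * s j j - s j i * s i j) by rewrite ij1; ring.
have -> : s i c * (s i i * s j j - s j i * s i j) =
  s i i * (s i c * s j j - s j c * s i j)
  - s i j * (s i c * s j i - s j c * s i i) by ring.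
by rewrite cj0 ci0; ring.
Qed.

(** Any member of an independent family has infinite order; the parameter at
    indices 1 and 2 is one of them. *)
Lemma free_parameter :
  exists2 t : F, t != 0 & forall k : int, t ^ k = 1 -> k = 0.
Proof.
have [k1 k2] : (1 < n)%N /\ (2 < n)%N by lia.
pose p : 'I_n * 'I_n := (Ordinal k1, Ordinal k2).
have pP : free_pair p by [].
have [q0 q_free] := q_indep; exists (q p.1 p.2) => [|k qk]; first exact: q0.
have prod1 : \prod_(r | free_pair r) q r.1 r.2 ^ (if r == p then k else 0) = 1.
  rewrite (bigD1 p) // eqxx qk [LHS]mul1r.
  by apply: big1 => r /andP[_ /negPf->].
by have := q_free _ prod1 p pP; rewrite eqxx.
Qed.

(** The first index is linked to the last two; any two of the others are linked
    to each other, and there are at least three of them. *)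
Lemma two_linked i : exists j k, [/\ linked i j, linked i k & j != k].
Proof.
have [k1 k2 k3] : [/\ (1 < n)%N, (2 < n)%N & (3 < n)%N] by split; lia.
have [l1 l2] : (n - 1 < n)%N /\ (n - 2 < n)%N by lia.
have linkE j : linked i j = (i != j) &&
    ~~ ((minn i j == 0%N) && (maxn i j + 2 < n)%N).
  rewrite /linked /free_pair /= -val_eqE /=.
  by case: ltngtP => //= _; rewrite ?andbF ?orbF.
have [i0|[i1|[i2|i3]]] : i = 0%N :> nat \/ i = 1%N :> nat \/ i = 2%N :> nat \/
  (2 < i)%N by lia.
- exists (Ordinal l1), (Ordinal l2); rewrite !linkE -!val_eqE /= i0.
  by split; lia.
- exists (Ordinal k2), (Ordinal k3); rewrite !linkE -!val_eqE /= i1.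
  by split; lia.
- exists (Ordinal k1), (Ordinal k3); rewrite !linkE -!val_eqE /= i2.
  by split; lia.
- exists (Ordinal k1), (Ordinal k2); rewrite !linkE -!val_eqE /=.
  by split; lia.
Qed.

Lemma linked_last (l i : 'I_n) : l = n.-1 :> nat -> i != l -> linked i l.
Proof.
move=> lE il; apply/orP; left; rewrite /free_pair /=.
have := ltn_ord i; have := ltn_ord l; move: il; rewrite -val_eqE /=; lia.
Qed.

(** Linked to [j] and to [k], row [i] is supported in [{i, j}] and in [{i, k}],
    hence in [{i}].  Linked diagonal entries have product 1, so they are equal
    to the same sign, and every index is linked to the last one. *)
Lemma lambda_rigid (s : 'M[int]_n) :
  (forall m m', lambda_value q (s *m m) (s *m m') = lambda_value q m m') ->
  s = 1%:M \/ s = (- 1)%:M.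
Proof.
move=> /lambda_preserving_minors sP.
have link_neq i j : linked i j -> i != j.
  by rewrite /linked /free_pair /=; apply: contraTneq => ->; rewrite ltnn.
have off i c : c != i -> s i c = 0.
  move=> ci; have [j [k [ij ik jk]]] := two_linked i.
  have [cj|cj] := eqVneq c j.
    apply: (minor_preserving_entry (sP _ _ ik)) => //; first exact: link_neq.
    by rewrite cj.
  by apply: (minor_preserving_entry (sP _ _ ij)) => //; apply: link_neq.
have diag i j : linked i j -> s i i * s j j = 1.
  move=> ij; have := sP _ _ ij (delta_mx i 0) (delta_mx j 0).
  rewrite /minor -!colE !mxE !eqxx [j == i]eq_sym (negPf (link_neq _ _ ij)) /=.
  by rewrite (off j i) ?link_neq // mul0r mulr0 subr0 subr0 mulr1.
have ltl : (n.-1 < n)%N by lia.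
pose l := Ordinal ltl.
have diag_l i : s i i = s l l.
  have [->//|il] := eqVneq i l.
  have lE : l = n.-1 :> nat by [].
  by case: (int_mul_eq1 (diag _ _ (linked_last lE il))).
have sE : s = (s l l)%:M.
  apply/matrixP => i j; rewrite mxE; case: eqVneq => [->|ij].
    by rewrite diag_l.
  by rewrite off // eq_sym.
have [j [_ [lj _ _]]] := two_linked l.
by have [_ [e|e]] := int_mul_eq1 (diag _ _ lj); rewrite sE e; [left | right].
Qed.

End Rigidity.

(** * The automorphism groups *)

Unset Implicit Arguments.
Unset Strict Implicit.

Theorem proposition3p3 (F : fieldType) (n : nat) (q : 'M[F]_n)
    (A : unitAlgType F) (X : 'I_n -> A)
    (n_ge5 : (5 <= n)%N)
    (q_anti : mult_antisymmetric q)
    (torusA : is_quantum_torus q X)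
    (q_row1 : forall i j : 'I_n,
       i = 0%N :> nat -> (j + 2 < n)%N -> q i j = 1)
    (q_indep : mult_independent
       (fun p : 'I_n * 'I_n =>
          (p.1 < p.2)%N && ~~ ((p.1 == 0%N :> nat) && (p.2 + 2 < n)%N))
       (fun p : 'I_n * 'I_n => q p.1 p.2)) :
  exists (iso : {multiplicative lambda_aut (torus_lambda X) -> 'Z_2})
         (scal : {multiplicative zhom F n -> alg_aut A})
         (ind : {multiplicative alg_aut A -> lambda_aut (torus_lambda X)}),
    [/\ bijective iso,
        forall (phi : zhom F n) (m : 'cV[int]_n),
          scal phi (monomial X m) = phi m *: monomial X m,
        forall (theta : alg_aut A) (m : 'cV[int]_n), exists2 a : F, a != 0 &
          theta (monomial X m) = a *: monomial X (ind theta *m m)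
      & short_exact scal (iso \o ind)].
Proof.
have X_rel : torus_relations q X by case: torusA.
have X_unit := monomial_unit X_rel.
have n_ge4 : (4 <= n)%N by apply: ltnW.
have [t t0 t_free] := free_parameter n_ge4 q_indep.
have /choice[scal scalP] := scalar_aut_exists q_anti torusA.
have ind_exists (theta : alg_aut A) :
    exists s : lambda_aut (torus_lambda X), induces X theta s.
  have [s sP] := induced_matrix q_anti torusA t0 t_free theta.
  by exists (LambdaAut (induced_lambda_preserving q_anti torusA t0 t_free sP)).
have /choice[ind indP] := ind_exists.
have ind_unique (theta : alg_aut A) (s : lambda_aut (torus_lambda X)) :
    induces X theta s -> ind theta = s.
  move=> sP; apply: val_inj.
  exact: (induced_matrix_unique q_anti torusA t0 t_free (indP theta) sP).
have aut_ext (theta eta : alg_aut A) :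
    (forall m, theta (monomial X m) = eta (monomial X m)) ->
    theta = eta.
  move=> te; apply: (torus_alg_aut_ext torusA) => i.
  by rewrite -(monomial_delta X) te.
have scalM : {morph scal : phi psi / (phi * psi)%g}.
  move=> phi psi; apply: aut_ext => m.
  rewrite scalP -[RHS]/(scal phi (scal psi (monomial X m))) scalP linearZ /=.
  by rewrite scalP scalerA mulrC.
have indM : {morph ind : theta eta / (theta * eta)%g}.
  by move=> theta eta; apply: ind_unique => m; apply: induced_matrixM.
have ind1 : ind 1%g = 1%g.
  by apply: ind_unique => m; rewrite mul1mx; apply: proportional_refl.
have [inv invX] := inversion_aut q_anti torusA.
have ind_inv : ind inv = (- 1)%:M :> 'M[int]_n.
  apply/matrixP => i j.
  have : ind inv *m delta_mx j 0 = - delta_mx j 0 :> 'cV_n.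
    apply: (monomial_proportional_inj q_anti torusA t0 t_free).
    apply: proportional_trans (proportional_sym (indP _ _)) _.
    rewrite monomial_delta invX; apply: proportional_sym.
    rewrite -(monomial_delta X j).
    exact: (monomialN_proportional q_anti torusA).
  by rewrite -colE => /colP/(_ i); rewrite !mxE andbT mulNrn.
have one_neq : (1%:M : 'M[int]_n) != (- 1)%:M.
  apply/eqP => /matrixP/(_ (Ordinal (ltnW n_ge4)) (Ordinal (ltnW n_ge4))).
  by rewrite !mxE eqxx.
have rigid (s : lambda_aut (torus_lambda X)) : s = 1%g \/ s = ind inv.
  have /andP[_ /asboolP sP] := lambda_autP s.
  have [m m'|sE|sE] := lambda_rigid n_ge4 q_anti q_row1 q_indep (s := s).
  - apply: (@scaler_unit_inj _ A 1); first exact: unitr1.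
    by rewrite -!(torus_lambdaE q_anti X_rel).
  - by left; apply: val_inj.
  - by right; apply: val_inj; rewrite /= sE ind_inv.
(* By rigidity the target has two elements, and [iso] tells them apart; the
   group law of 'Z_2 is its addition. *)
pose iso (s : lambda_aut (torus_lambda X)) : 'Z_2 := (s != 1%g)%:R.
have inv1 : ind inv != 1%g.
  by apply: contraNneq one_neq => i1; rewrite -ind_inv i1.
have inv2 : (ind inv * ind inv = 1)%g.
  by apply: val_inj => /=; rewrite ind_inv -scalar_mxM mulrNN mulr1.
have isoM : {morph iso : s s' / (s * s')%g}.
  move=> s s'; rewrite /iso.
  have [->|->] := rigid s; have [->|->] := rigid s';
    by rewrite ?mulg1 ?mul1g ?inv2 ?eqxx ?inv1; apply: val_inj.
have iso_bij : bijective iso.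
  exists (fun z : 'Z_2 => if z == 0 then 1%g else ind inv) => [s|z].
    by rewrite /iso; have [->|->] := rigid s; rewrite ?eqxx ?inv1.
  rewrite /iso; case: (eqVneq z 0) => [->|z0]; rewrite ?eqxx ?inv1 //.
  by apply: val_inj; case: z z0 => [[|[|?]] ?].
pose isoH := HB.pack_for {multiplicative lambda_aut (torus_lambda X) -> 'Z_2}
  iso (isMultiplicative.Build _ _ iso isoM).
pose scalH := HB.pack_for {multiplicative zhom F n -> alg_aut A}
  scal (isMultiplicative.Build _ _ scal scalM).
pose indH := HB.pack_for {multiplicative alg_aut A -> lambda_aut (torus_lambda X)}
  ind (isMultiplicative.Build _ _ ind indM).
exists isoH, scalH, indH; split => //.
split=> /= [phi psi phipsi|theta|z].
- apply: val_inj; apply/funext => m; apply: (scaler_unit_inj (X_unit m)).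
  by rewrite -!scalP phipsi.
- split=> [/= iso1|[phi <-]].
    have indth : ind theta = 1%g.
      by have [//|e] := rigid (ind theta); move: iso1; rewrite /iso e inv1.
    have thX m : exists a, a != 0 /\ theta (monomial X m) = a *: monomial X m.
      by have [a a0] := indP theta m; rewrite indth mul1mx; exists a.
    (* The scalars in front of the monomials form the required character. *)
    have /choice[a aP] := thX.
    have aX m : theta (monomial X m) = a m *: monomial X m by case: (aP m).
    suff a_hom : is_zhom a.
      by exists (ZHom a_hom); apply: aut_ext => m; rewrite scalP aX.
    apply/asboolP; split=> [m|m m']; first by case: (aP m).
    apply: (scaler_unit_inj (X_unit (m + m'))); rewrite -aX.
    have [c c0 ->] := monomialD_proportional q_anti X_rel m m'.
    rewrite linearZ rmorphM /= !aX -scalerAl -scalerAr !scalerA.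
    by congr (_ *: _); ring.
  suff -> : ind (scal phi) = 1%g by rewrite /iso eqxx.
  apply: ind_unique => m; rewrite mul1mx scalP.
  by exists (phi m); first exact: zhom_neq0.
- have [iso' _ isoK] := iso_bij.
  have [e|e] := rigid (iso' z).
    by exists 1%g; rewrite ind1 -e isoK.
  by exists inv; rewrite -e isoK.
Qed.
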